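(* Let $\sigma\in\{+,-\}$. (1) In the unrestricted Laurent--Weyl algebra (i.e. in $M_4(\mathcal W)$, with $\mathcal W$ as in the context), the seam $S_\sigma$ satisfies $$S_\sigma^4-\frac32S_\sigma^2+\frac{q+q^{-1}}2S_\sigma+\left[\frac1{16}-\frac1{16}(q+q^{-1})^2\right]I=0.$$ (2) Let $N\ge2$, $1\le M<N$, $\gcd(M,N)=1$, $q=e^{i\pi M/N}$, $\theta=\pi M/N$, and take the standard $N$-dimensional clock--shift realization. For every $\eta\in\mathbb Z_{2N}$ the output-normalized seam $S^{(\eta)}_\sigma$ on $\mathbb C^2\otimes\mathbb C^2\otimes\mathbb C^N$ has spectrum $$\operatorname{spec}S_\sigma^{(\eta)}=\left\{-\frac12\pm\cos\frac\theta2,\ \frac12\pm\sin\frac\theta2\right\},$$ and these four eigenvalues are distinct, each with multiplicity $N$.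
   Context: The unrestricted Laurent--Weyl algebra $\mathcal W$ is the unital algebra over $\mathbb C[q,q^{-1}]$ generated by invertible elements $X,Z$ subject only to $ZX=q^2XZ$; $Y_{m,n}=X^mZ^n$. With $4\times4$ matrix units $E_{rc}=|r\rangle\langle c|$ in the two-spin basis $|0\rangle=|00\rangle,|1\rangle=|01\rangle,|2\rangle=|10\rangle,|3\rangle=|11\rangle$ of $\mathbb C^2\otimes\mathbb C^2$ (tensor signs omitted): $$\begin{aligned}S_+=\tfrac12\bigl[&-E_{01}Y_{-1,-1}+q^3E_{02}Y_{-1,0}-q^4E_{03}Y_{-2,-1}-q^2E_{10}Y_{1,1}+q^2E_{12}Y_{0,1}-qE_{13}Y_{-1,0}\\&+q^{-3}E_{20}Y_{1,0}+q^{-2}E_{21}Y_{0,-1}+q^2E_{23}Y_{-1,-1}-E_{30}Y_{2,1}-q^{-1}E_{31}Y_{1,0}+E_{32}Y_{1,1}\bigr],\\ S_-=\tfrac12\bigl[&E_{01}Y_{-1,1}-qE_{02}Y_{-1,0}-E_{03}Y_{-2,1}+q^{-2}E_{10}Y_{1,-1}+q^2E_{12}Y_{0,-1}+q^3E_{13}Y_{-1,0}\\&-q^{-1}E_{20}Y_{1,0}+q^{-2}E_{21}Y_{0,1}-q^{-2}E_{23}Y_{-1,1}-q^{-4}E_{30}Y_{2,-1}+q^{-3}E_{31}Y_{1,0}-E_{32}Y_{1,-1}\bigr].\end{aligned}$$ Clock--shift realization: on $\mathbb C^N$ with basis $|1\rangle,\dots,|N\rangle$ (indices mod $N$), $Z|n\rangle=\omega^n|n\rangle$,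 $X|n\rangle=|n+1\rangle$, $\omega=q^2$. Output normalization: $\varepsilon=e^{i\pi/N}$, $f_\eta=\varepsilon^\eta$, $F_+^{(\eta)}=\operatorname{diag}(1,f_\eta)$, $F_-^{(\eta)}=\operatorname{diag}(f_\eta,1)$, and $S_\sigma^{(\eta)}=F^{(\eta)}_{\sigma,B}S_\sigma F^{(\eta)\dagger}_{\sigma,B}$, where $F_{\sigma,B}^{(\eta)}$ acts on the second physical spin only. *)

(* Defs.v *)
From HB Require Import structures.
From mathcomp Require Import all_boot all_order all_algebra.
From mathcomp Require Import boolp reals trigo.
From mathcomp Require Import complex mxtens.

Set Implicit Arguments.
Unset Strict Implicit.
Unset Printing Implicit Defensive.

Import Order.TTheory GRing.Theory Num.Theory.
Local Open Scope ring_scope.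
Local Open Scope quotient_scope.
Local Open Scope complex_scope.
Local Open Scope sesquilinear_scope.

(* The Laurent polynomial ring F[q, q^-1], as the subring of the field F(q) of
   the fractions p / q^n. *)
Section Laurent.
Variable F : fieldType.

Definition is_laurent (x : {fraction {poly F}}) : bool :=
  `[< exists (p : {poly F}) (n : nat), x = tofrac p / tofrac 'X ^+ n >].

Lemma tofracX_neq0 : tofrac ('X : {poly F}) != 0.
Proof. by rewrite tofrac_eq0 polyX_eq0. Qed.

Lemma is_laurent_poly (p : {poly F}) : is_laurent (tofrac p).
Proof. by apply/asboolP; exists p, 0%N; rewrite expr0 divr1. Qed.

Lemma is_laurent_subring : subring_closed is_laurent.
Proof.
have X0 n : tofrac ('X : {poly F}) ^+ n != 0 by rewrite expf_neq0// tofracX_neq0.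
have divB (a b c d : {fraction {poly F}}) : c != 0 -> d != 0 ->
    a / c - b / d = (a * d - b * c) / (c * d).
  by move=> c0 d0; rewrite -mulNr addf_div// mulNr.
split=> [|x y /asboolP[p [m ->]] /asboolP[r [n ->]]
         |x y /asboolP[p [m ->]] /asboolP[r [n ->]]].
- by rewrite -[1](rmorph1 (@tofrac {poly F})); exact: is_laurent_poly.
- apply/asboolP; exists (p * 'X ^+ n - r * 'X ^+ m), (m + n)%N.
  rewrite rmorphB !rmorphM /= !rmorphXn /= exprD.
  exact: divB.
- apply/asboolP; exists (p * r), (m + n)%N.
  by rewrite rmorphM /= exprD; exact: mulf_div.
Qed.

HB.instance Definition _ :=
  GRing.isSubringClosed.Build {fraction {poly F}} is_laurent is_laurent_subring.

Record laurent :=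
  Laurent { laurent_val : {fraction {poly F}}; _ : is_laurent laurent_val }.

HB.instance Definition _ := [isSub for laurent_val].
HB.instance Definition _ := [Choice of laurent by <:].
HB.instance Definition _ := [SubChoice_isSubComNzRing of laurent by <:].

Definition laurent_unit : {pred laurent} :=
  [pred x | (val x != 0) && is_laurent (val x)^-1].

Definition laurent_inv (x : laurent) : laurent := insubd x (val x)^-1.

Fact laurent_mulVx : {in laurent_unit, left_inverse 1 laurent_inv *%R}.
Proof.
move=> x /andP[x0 xV]; apply: val_inj.
by rewrite rmorphM rmorph1 /= val_insubd xV mulVf.
Qed.

Fact laurent_unitPl (x y : laurent) : y * x = 1 -> laurent_unit x.
Proof.
move=> /(congr1 val); rewrite rmorphM rmorph1 /= => yx.
have x0 : val x != 0.
  by apply/eqP => x0; move/eqP: yx; rewrite x0 mulr0 eq_sym oner_eq0.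
apply/andP; split=> //.
by rewrite -[(val x)^-1]mul1r -yx mulfK//; exact: valP.
Qed.

Fact laurent_inv_out : {in [predC laurent_unit], laurent_inv =1 id}.
Proof.
move=> x; rewrite !inE negb_and negbK => /orP[/eqP x0|xV]; apply: val_inj.
  by rewrite val_insubd x0 invr0; case: ifP.
by rewrite val_insubd (negbTE xV).
Qed.

HB.instance Definition _ := GRing.ComNzRing_hasMulInverse.Build laurent
  laurent_mulVx laurent_unitPl laurent_inv_out.

Definition laurent_q : laurent := Laurent (is_laurent_poly 'X).

Lemma laurent_q_unit : laurent_q \is a GRing.unit.
Proof.
apply/andP; split; first exact: tofracX_neq0.
by apply/asboolP; exists 1, 1%N; rewrite rmorph1 mul1r expr1.
Qed.

End Laurent.

(* The Laurent-Weyl algebra, by generators and relations: noncommutative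
   polynomial expressions over K = F[q, q^-1] in X, X^-1, Z, Z^-1, modulo the
   smallest congruence that contains the axioms of K-algebras, the invertibility
   of X and Z, and ZX = q^2 XZ. *)
Section LaurentWeyl.
Variable F : fieldType.
Local Notation K := (laurent F).
Local Notation q := (laurent_q F).

Inductive lw_term :=
  | LwConst of K
  | LwX | LwXinv | LwZ | LwZinv
  | LwAdd of lw_term & lw_term
  | LwMul of lw_term & lw_term.

HB.instance Definition _ := gen_eqMixin lw_term.
HB.instance Definition _ := gen_choiceMixin lw_term.

Inductive lw_cong : lw_term -> lw_term -> Prop :=
  | lw_refl s : lw_cong s s
  | lw_sym s t : lw_cong s t -> lw_cong t s
  | lw_trans s t u : lw_cong s t -> lw_cong t u -> lw_cong s u
  | lw_addC s t : lw_cong (LwAdd s t) (LwAdd t s)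
  | lw_addA s t u : lw_cong (LwAdd s (LwAdd t u)) (LwAdd (LwAdd s t) u)
  | lw_add0 s : lw_cong (LwAdd (LwConst 0) s) s
  | lw_mulA s t u : lw_cong (LwMul s (LwMul t u)) (LwMul (LwMul s t) u)
  | lw_mul1l s : lw_cong (LwMul (LwConst 1) s) s
  | lw_mul0 s : lw_cong (LwMul (LwConst 0) s) (LwConst 0)
  | lw_mulDl s t u :
      lw_cong (LwMul (LwAdd s t) u) (LwAdd (LwMul s u) (LwMul t u))
  | lw_mulDr s t u :
      lw_cong (LwMul u (LwAdd s t)) (LwAdd (LwMul u s) (LwMul u t))
  | lw_constD a b : lw_cong (LwConst (a + b)) (LwAdd (LwConst a) (LwConst b))
  | lw_constM a b : lw_cong (LwConst (a * b)) (LwMul (LwConst a) (LwConst b))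
  | lw_constC a s : lw_cong (LwMul (LwConst a) s) (LwMul s (LwConst a))
  | lw_congD s s' t t' :
      lw_cong s s' -> lw_cong t t' -> lw_cong (LwAdd s t) (LwAdd s' t')
  | lw_congM s s' t t' :
      lw_cong s s' -> lw_cong t t' -> lw_cong (LwMul s t) (LwMul s' t')
  | lw_XXinv : lw_cong (LwMul LwX LwXinv) (LwConst 1)
  | lw_XinvX : lw_cong (LwMul LwXinv LwX) (LwConst 1)
  | lw_ZZinv : lw_cong (LwMul LwZ LwZinv) (LwConst 1)
  | lw_ZinvZ : lw_cong (LwMul LwZinv LwZ) (LwConst 1)
  | lw_ZX :
      lw_cong (LwMul LwZ LwX) (LwMul (LwConst (q ^+ 2)) (LwMul LwX LwZ)).

Definition lw_rel (s t : lw_term) : bool := `[< lw_cong s t >].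

Lemma lw_rel_equiv : equiv_class_of lw_rel.
Proof.
split.
- by move=> s; apply/asboolP; exact: lw_refl.
- by move=> s t; apply/asboolP/asboolP; exact: lw_sym.
- move=> t s u /asboolP st /asboolP tu; apply/asboolP; exact: lw_trans st tu.
Qed.

Canonical lw_equiv := EquivRelPack lw_rel_equiv.

Definition laurent_weyl := {eq_quot lw_equiv}.
HB.instance Definition _ := Choice.on laurent_weyl.

Local Notation W := laurent_weyl.

Definition lw_pi (t : lw_term) : W := \pi_W t.

Lemma lw_piP s t : lw_pi s = lw_pi t <-> lw_cong s t.
Proof.
split=> [/eqmodP/asboolP //|st].
by apply/eqmodP/asboolP.
Qed.

Lemma lw_reprK (x : W) : lw_pi (repr x) = x.
Proof. exact: reprK. Qed.

Definition lw_add (x y : W) := lw_pi (LwAdd (repr x) (repr y)).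
Definition lw_mul (x y : W) := lw_pi (LwMul (repr x) (repr y)).
Definition lw_const (a : K) := lw_pi (LwConst a).
Definition lw_opp (x : W) := lw_mul (lw_const (-1)) x.

Lemma lw_addE s t : lw_add (lw_pi s) (lw_pi t) = lw_pi (LwAdd s t).
Proof. by apply/lw_piP; apply: lw_congD; apply/lw_piP; rewrite lw_reprK. Qed.

Lemma lw_mulE s t : lw_mul (lw_pi s) (lw_pi t) = lw_pi (LwMul s t).
Proof. by apply/lw_piP; apply: lw_congM; apply/lw_piP; rewrite lw_reprK. Qed.

Lemma lw_ind (P : W -> Prop) : (forall t, P (lw_pi t)) -> forall x, P x.
Proof. by move=> H x; rewrite -[x]lw_reprK. Qed.

Fact lw_addrA : associative lw_add.
Proof.
by elim/lw_ind=> s; elim/lw_ind=> t; elim/lw_ind=> u; rewrite !lw_addE;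
  apply/lw_piP; exact: lw_addA.
Qed.

Fact lw_addrC : commutative lw_add.
Proof.
by elim/lw_ind=> s; elim/lw_ind=> t; rewrite !lw_addE; apply/lw_piP;
  exact: lw_addC.
Qed.

Fact lw_add0r : left_id (lw_const 0) lw_add.
Proof. by elim/lw_ind=> s; rewrite lw_addE; apply/lw_piP; exact: lw_add0. Qed.

Fact lw_mulrA : associative lw_mul.
Proof.
by elim/lw_ind=> s; elim/lw_ind=> t; elim/lw_ind=> u; rewrite !lw_mulE;
  apply/lw_piP; exact: lw_mulA.
Qed.

Fact lw_mul1r : left_id (lw_const 1) lw_mul.
Proof. by elim/lw_ind=> s; rewrite lw_mulE; apply/lw_piP; exact: lw_mul1l. Qed.

Fact lw_const_central a x : lw_mul (lw_const a) x = lw_mul x (lw_const a).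
Proof.
by move: x; elim/lw_ind=> s; rewrite !lw_mulE; apply/lw_piP; exact: lw_constC.
Qed.

Fact lw_mulr1 : right_id (lw_const 1) lw_mul.
Proof. by move=> x; rewrite -lw_const_central lw_mul1r. Qed.

Fact lw_mulrDl : left_distributive lw_mul lw_add.
Proof.
by elim/lw_ind=> s; elim/lw_ind=> t; elim/lw_ind=> u;
  rewrite !(lw_addE, lw_mulE); apply/lw_piP; exact: lw_mulDl.
Qed.

Fact lw_mulrDr : right_distributive lw_mul lw_add.
Proof.
by elim/lw_ind=> s; elim/lw_ind=> t; elim/lw_ind=> u;
  rewrite !(lw_addE, lw_mulE); apply/lw_piP; exact: lw_mulDr.
Qed.

Fact lw_constrD a b : lw_const (a + b) = lw_add (lw_const a) (lw_const b).
Proof. by rewrite lw_addE; apply/lw_piP; exact: lw_constD. Qed.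

Fact lw_constrM a b : lw_const (a * b) = lw_mul (lw_const a) (lw_const b).
Proof. by rewrite lw_mulE; apply/lw_piP; exact: lw_constM. Qed.

Fact lw_mulr0l x : lw_mul (lw_const 0) x = lw_const 0.
Proof. by move: x; elim/lw_ind=> s; rewrite lw_mulE; apply/lw_piP; exact: lw_mul0. Qed.

Fact lw_addNr : left_inverse (lw_const 0) lw_opp lw_add.
Proof.
by move=> x; rewrite /lw_opp -{2}[x]lw_mul1r -lw_mulrDl -lw_constrD addNr
  lw_mulr0l.
Qed.

HB.instance Definition _ := GRing.isPzRing.Build W
  lw_addrA lw_addrC lw_add0r lw_addNr lw_mulrA lw_mul1r lw_mulr1
  lw_mulrDl lw_mulrDr.

(* W acts on the K-valued functions on the integers by (X f)(n) = f(n - 1) and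
   (Z f)(n) = q^(2n) f(n); in particular 1 != 0 in W. *)
Fixpoint lw_act (t : lw_term) (f : int -> K) : int -> K :=
  match t with
  | LwConst a => fun n => a * f n
  | LwX => fun n => f (n - 1)
  | LwXinv => fun n => f (n + 1)
  | LwZ => fun n => q ^ (2 * n) * f n
  | LwZinv => fun n => q ^ (- (2 * n)) * f n
  | LwAdd s t => fun n => lw_act s f n + lw_act t f n
  | LwMul s t => lw_act s (lw_act t f)
  end.

Lemma lw_act_ext t f g : f =1 g -> lw_act t f =1 lw_act t g.
Proof.
by elim: t f g => //= [a|||||s IHs t IHt|s IHs t IHt] f g fg n;
  rewrite ?fg// ?(IHs _ _ fg) ?(IHt _ _ fg)//; apply/IHs/IHt.
Qed.

Lemma lw_actD t f g n :
  lw_act t (fun m => f m + g m) n = lw_act t f n + lw_act t g n.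
Proof.
elim: t f g n => //= [a|||s IHs t IHt|s IHs t IHt] f g n;
  rewrite ?mulrDr//; first by rewrite IHs IHt addrACA.
by rewrite -IHs; apply: lw_act_ext => m; exact: IHt.
Qed.

Lemma lw_actZ t a f n : lw_act t (fun m => a * f m) n = a * lw_act t f n.
Proof.
elim: t f n => //= [b|||s IHs t IHt|s IHs t IHt] f n;
  rewrite ?mulrDr; rewrite 1?mulrCA//; first by rewrite IHs IHt.
by rewrite -IHs; apply: lw_act_ext => m; exact: IHt.
Qed.

Lemma lw_act_cong s t : lw_cong s t -> forall f, lw_act s f =1 lw_act t f.
Proof.
have qU := laurent_q_unit F.
elim=> {s t} //=.
- by move=> s t _ IH f n; rewrite IH.
- by move=> s t u _ IHs _ IHt f n; rewrite IHs IHt.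
- by move=> s t f n; rewrite addrC.
- by move=> s t u f n; rewrite addrA.
- by move=> s f n; rewrite mul0r add0r.
- by move=> s f n; rewrite mul1r.
- by move=> s f n; rewrite !mul0r.
- by move=> s t u f n; rewrite lw_actD.
- by move=> a b f n; rewrite mulrDl.
- by move=> a b f n; rewrite mulrA.
- by move=> a s f n; rewrite lw_actZ.
- by move=> s s' t t' _ IHs _ IHt f n; rewrite IHs IHt.
- by move=> s s' t t' _ IHs _ IHt f n; rewrite IHs; apply: lw_act_ext => m; exact: IHt.
- by move=> f n; rewrite subrK mul1r.
- by move=> f n; rewrite addrK mul1r.
- by move=> f n; rewrite mulrA -exprzDr// addrN expr0z.
- by move=> f n; rewrite mulrA -exprzDr// addNr expr0z.
- move=> f n; rewrite mulrA exprnP -exprzDr//; congr (q ^ _ * _).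
  by rewrite mulrBr mulr1 addrC subrK.
Qed.

Fact lw_oner_neq0 : (1 : W) != 0.
Proof.
apply/eqP => /lw_piP /lw_act_cong/(_ (fun=> 1) 0)/= /eqP.
by rewrite mul1r mul0r oner_eq0.
Qed.

HB.instance Definition _ := GRing.PzSemiRing_isNonZero.Build W lw_oner_neq0.

Definition lw_scale (a : K) (x : W) : W := lw_const a * x.

Fact lw_scaleA a b x : lw_scale a (lw_scale b x) = lw_scale (a * b) x.
Proof. by rewrite /lw_scale mulrA; congr (_ * _); rewrite lw_constrM. Qed.

Fact lw_scale1 : left_id 1 lw_scale.
Proof. by move=> x; rewrite /lw_scale; exact: mul1r. Qed.

Fact lw_scaleDr : right_distributive lw_scale +%R.
Proof. by move=> a x y; rewrite /lw_scale mulrDr. Qed.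

Fact lw_scaleDl x : {morph lw_scale^~ x : a b / a + b}.
Proof. by move=> a b; rewrite /lw_scale -mulrDl; congr (_ * _); exact: lw_constrD. Qed.

HB.instance Definition _ := GRing.Zmodule_isLmodule.Build K W
  lw_scaleA lw_scale1 lw_scaleDr lw_scaleDl.

Fact lw_scaleAl (a : K) (x y : W) : a *: (x * y) = (a *: x) * y.
Proof. exact: mulrA. Qed.

HB.instance Definition _ := GRing.Lmodule_isLalgebra.Build K W lw_scaleAl.

Fact lw_scaleAr (a : K) (x y : W) : a *: (x * y) = x * (a *: y).
Proof.
rewrite [LHS]mulrA [RHS]mulrA; congr (_ * _); exact: lw_const_central.
Qed.

HB.instance Definition _ := GRing.Lalgebra_isAlgebra.Build K W lw_scaleAr.

Definition lwX : W := lw_pi LwX.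
Definition lwXinv : W := lw_pi LwXinv.
Definition lwZ : W := lw_pi LwZ.
Definition lwZinv : W := lw_pi LwZinv.

End LaurentWeyl.

Inductive sign := Plus | Minus.

(* The seam, for a ring A in which X and Z have the inverses X' and Z', and with
   coefficients in K acting on A through iota. *)
Section Seam.
Variables (K : comUnitRingType) (q : K).
Variables (A : pzRingType) (iota : {rmorphism K -> A}) (X X' Z Z' : A).

Definition powz (x x' : A) (m : int) : A :=
  match m with Posz k => x ^+ k | Negz k => x' ^+ k.+1 end.

Definition Ymon (m n : int) : A := powz X X' m * powz Z Z' n.

Definition Eterm (r c : 'I_4) (a : K) (m n : int) : 'M[A]_4 :=
  (iota a * Ymon m n) *: delta_mx r c.

Local Notation E := Eterm.

Definition seam (sigma : sign) : 'M[A]_4 :=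
  iota 2^-1 *: match sigma with
  | Plus =>
      E 0 1 (-1) (-1) (-1) + E 0 2 (q ^ 3) (-1) 0 + E 0 3 (- q ^ 4) (-2) (-1)
    + E 1 0 (- q ^ 2) 1 1 + E 1 2 (q ^ 2) 0 1 + E 1 3 (- q) (-1) 0
    + E 2 0 (q ^ (-3)) 1 0 + E 2 1 (q ^ (-2)) 0 (-1) + E 2 3 (q ^ 2) (-1) (-1)
    + E 3 0 (-1) 2 1 + E 3 1 (- q ^ (-1)) 1 0 + E 3 2 1 1 1
  | Minus =>
      E 0 1 1 (-1) 1 + E 0 2 (- q) (-1) 0 + E 0 3 (-1) (-2) 1
    + E 1 0 (q ^ (-2)) 1 (-1) + E 1 2 (q ^ 2) 0 (-1) + E 1 3 (q ^ 3) (-1) 0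
    + E 2 0 (- q ^ (-1)) 1 0 + E 2 1 (q ^ (-2)) 0 1 + E 2 3 (- q ^ (-2)) (-1) 1
    + E 3 0 (- q ^ (-4)) 2 (-1) + E 3 1 (q ^ (-3)) 1 0 + E 3 2 (-1) 1 (-1)
  end.

End Seam.

Definition weyl_seam (F : fieldType) (sigma : sign) : 'M[laurent_weyl F]_4 :=
  seam (laurent_q F) (in_alg (laurent_weyl F))
    (lwX F) (lwXinv F) (lwZ F) (lwZinv F) sigma.

Section ClockShift.
Variables (R : realType) (N : nat).
Local Notation C := R[i].

Definition expi (t : R) : C := cos t +i* sin t.

(* The index n : 'I_N stands for the basis vector |n + 1>. *)
Definition clock (omega : C) : 'M[C]_N :=
  diag_mx (\row_(n < N) omega ^+ n.+1).

Definition shift : 'M[C]_N := \matrix_(r, c) (r == ordS c)%:R.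

(* The identification of M_4(M_N(C)) with the operators on C^4 (x) C^N. *)
Definition tensor_op (S : 'M['M[C]_N]_4) : 'M[C]_(2 * 2 * N) :=
  \sum_(r < 4) \sum_(c < 4) (delta_mx r c : 'M[C]_(2 * 2)) *t S r c.

Definition clock_seam (q : C) (sigma : sign) : 'M[C]_(2 * 2 * N) :=
  tensor_op (seam q (@scalar_mx C N)
    shift (invmx shift) (clock (q ^+ 2)) (invmx (clock (q ^+ 2))) sigma).

(* The phase f_eta = epsilon^eta only depends on eta modulo 2N, as
   epsilon = exp(i pi / N). *)
Definition output_phase (eta : 'Z_(2 * N)) : C := expi (pi / N%:R) ^+ eta.

Definition output_diag (sigma : sign) (eta : 'Z_(2 * N)) : 'M[C]_2 :=
  let f := output_phase eta in
  diag_mx (\row_j match sigma with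
                  | Plus => if j == 0 then 1 else f
                  | Minus => if j == 0 then f else 1
                  end).

Definition output_op (sigma : sign) (eta : 'Z_(2 * N)) : 'M[C]_(2 * 2 * N) :=
  (1%:M *t output_diag sigma eta) *t 1%:M.

Definition normalized_seam (q : C) (sigma : sign) (eta : 'Z_(2 * N)) :
    'M[C]_(2 * 2 * N) :=
  output_op sigma eta *m clock_seam q sigma *m (output_op sigma eta)^t*.

End ClockShift.

(* Main.v *)
Require Import Defs.
From mathcomp Require Import all_boot all_order all_algebra.
From mathcomp Require Import reals trigo.
From mathcomp Require Import complex.
From mathcomp Require Import ring lra mxtens.

Set Implicit Arguments.
Unset Strict Implicit.
Unset Printing Implicit Defensive.

Import Order.TTheory GRing.Theory Num.Theory.
Local Open Scope ring_scope.
Local Open Scope complex_scope.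

(** Conjugating the seam by a diagonal matrix of monomials removes all the
    generators: S = D T D^-1, where T = (1/2) core a b is a scalar 4 x 4 matrix
    and {a, b} = {q, q^-1}.  The quartic is thus the characteristic polynomial
    of T; as ab = 1, it reads ((2T)^2 - 1)^2 = (4T - (a + b))^2.  At
    q = exp(i theta) this difference of squares has the four listed real roots,
    which are simple.  In the clock-shift realization S becomes similar to the
    Kronecker product of T with the identity of size N, so every multiplicity
    is N. *)

(** * The scalar matrix and its quartic equation *)

Section CorePoly.
Variables (K : comUnitRingType) (a b : K).

(** Twice the scalar matrix T. Leaving out the factor 1/2 keeps the next two identities polynomial
    in [a] and [b], and they hold without [a * b = 1]. *)
Definition core : 'M[K]_4 :=
  \matrix_(r, c) nth 0 (nth [::]
    [:: [:: 0;  1;   1;   1];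
        [:: 1;  0; - a; - a];
        [:: 1; - b;  0; - b];
        [:: 1; - b; - a;  0]] r) c.

(** The square is tabulated so that the fourth power becomes a single product of explicit
    matrices. *)
Lemma core_sqE : core ^+ 2 = \matrix_(r, c) nth 0 (nth [::]
    [:: [:: 3; - (b + b); - (a + a); - (a + b)];
        [:: - (a + a); 1 + a * b + a * b; 1 + a * a; 1 + a * b];
        [:: - (b + b); 1 + b * b; 1 + a * b + a * b; 1 + a * b];
        [:: - (a + b); 1 + a * b; 1 + a * b; 1 + a * b + a * b]] r) c.
Proof.
apply/matrixP => r c; rewrite expr2 -mulmxE mxE !big_ord_recl big_ord0.
case: r => [[|[|[|[|//]]]] lr]; case: c => [[|[|[|[|//]]]] lc];
  rewrite !mxE /=; ring.
Qed.

Lemma core_char : core ^+ 4 - (3 + 3 * (a * b)) *: core ^+ 2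
  + ((3 + a * b) * (a + b)) *: core - (a * b + a ^+ 2 + b ^+ 2)%:M = 0.
Proof.
rewrite -[4%N]/(2 * 2)%N exprM core_sqE expr2 -mulmxE.
apply/matrixP => r c; rewrite !mxE !big_ord_recl big_ord0.
case: r => [[|[|[|[|//]]]] lr]; case: c => [[|[|[|[|//]]]] lc];
  rewrite !mxE /=; ring.
Qed.

Lemma half_core_char : 2 \is a @GRing.unit K -> a * b = 1 ->
  let T := 2^-1 *: core in
  T ^+ 4 - (3 / 2) *: T ^+ 2 + ((a + b) / 2) *: T
    + (1 / 16 - 1 / 16 * (a + b) ^+ 2)%:M = 0.
Proof.
move=> U2 ab1 T; have h2 := mulVr U2.
have -> : 1 / 16 = 2^-1 ^+ 4 :> K by rewrite div1r exprVn -natrX.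
(* From here [2^-1] is any [h] with [h * 2 = 1]. Coefficients with too few factors [h] are
   multiplied by [h * 2] until all carry [h ^+ 4], so that the claim is [h ^+ 4] times the identity
   for [core]. *)
rewrite /T !exprZn; move: 2^-1 h2 {T} => h h2.
transitivity (h ^+ 4 *: (core ^+ 4 - (3 + 3 * (a * b)) *: core ^+ 2
  + ((3 + a * b) * (a + b)) *: core - (a * b + a ^+ 2 + b ^+ 2)%:M));
    last first.
  by rewrite core_char scaler0.
rewrite ab1 scalerDr scalerDr scalerBr scalerN !scalerA scale_scalar_mx.
have h3 : 3 * h * h ^+ 2 = h ^+ 4 * (3 + 3 * 1).
  by transitivity (3 * h * h ^+ 2 * (h * 2)); [rewrite h2 mulr1 | ring].
have h4 : (a + b) * h * h = h ^+ 4 * ((3 + 1) * (a + b)).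
  by transitivity ((a + b) * h * h * ((h * 2) * (h * 2)));
    [rewrite h2 !mulr1 | ring].
rewrite h3 h4; congr (_ + _); rewrite -raddfN /=; congr (_%:M).
have -> : (a + b) ^+ 2 = 2 * (a * b) + a ^+ 2 + b ^+ 2 by ring.
by rewrite ab1; ring.
Qed.

End CorePoly.

(** * Integer powers of an invertible element *)

Section Powz.
Variables (A : pzRingType) (x x' : A).
Hypotheses (xx' : x * x' = 1) (x'x : x' * x = 1).

Lemma powzS m : powz x x' (m + 1) = powz x x' m * x.
Proof.
case: m => [m|[|m]]; first by rewrite -PoszD addn1 /= exprSr.
  by rewrite /= expr1 x'x.
have -> : Negz m.+1 + 1 = Negz m by rewrite !NegzE -(addn1 m.+1) PoszD opprD
  addrNK.
by rewrite /= (exprSr _ m.+1) -mulrA x'x mulr1.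
Qed.

Lemma powzB m : powz x x' (m - 1) = powz x x' m * x'.
Proof. by rewrite -{2}[m](subrK 1) powzS -mulrA xx' mulr1. Qed.

Lemma powzD m n : powz x x' (m + n) = powz x x' m * powz x x' n.
Proof.
elim/int_ind: n => [|n IH|n IH]; first by rewrite addr0 mulr1.
  by rewrite -addn1 PoszD addrA powzS IH powzS mulrA.
by rewrite -addn1 PoszD opprD addrA powzB IH powzB mulrA.
Qed.

End Powz.

(** * Monomial gauge: the seam is conjugate to a scalar matrix *)

Section Conjugation.
Variables (K : comUnitRingType) (A : pzRingType) (iota : {rmorphism K -> A}).
Hypothesis iotaC : forall k x, iota k * x = x * iota k.

(** Induction on [m] in both directions. The downward step needs the relation for [v'], found by
    inserting [v * v' = 1] and cancelling the unit [k]. *)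
Lemma powz_skew u v v' k m : k \is a GRing.unit -> v * v' = 1 -> v' * v = 1 ->
    u * v = iota k * (v * u) ->
  u * powz v v' m = iota (k ^ m) * (powz v v' m * u).
Proof.
move=> kU vv' v'v uv.
have uv' : u * v' = iota k^-1 * (v' * u).
  rewrite -[X in v' * X]mulr1 -vv' (mulrA u) uv !mulrA -(mulrA _ v') -iotaC.
  by rewrite mulrA -rmorphM mulVr// rmorph1 mul1r v'v mul1r.
elim/int_ind: m => [|m IH|m IH].
- by rewrite expr0z rmorph1 /= !mul1r mulr1.
- rewrite -addn1 PoszD powzS// exprzDr// expr1z rmorphM mulrA IH -!mulrA uv.
  by rewrite (mulrA (powz _ _ _)) -iotaC -mulrA.
- rewrite -addn1 PoszD opprD powzB// exprzDr// exprN1 rmorphM mulrA IH -!mulrA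
  uv'.
  by rewrite (mulrA (powz _ _ _)) -iotaC -mulrA.
Qed.

Variables (q : K) (X X' Z Z' : A).
Hypothesis qU : q \is a GRing.unit.
Hypotheses (XX' : X * X' = 1) (X'X : X' * X = 1).
Hypotheses (ZZ' : Z * Z' = 1) (Z'Z : Z' * Z = 1).
Hypothesis ZX : Z * X = iota (q ^+ 2) * (X * Z).

(** Reordering Z^n X^m' costs q^(2nm'). First a single Z passes X^m', then X^m' passes Z^n; in this
    second use of [powz_skew] the factor appears inverted. *)
Lemma Ymon_mul m n m' n' :
  Ymon X X' Z Z' m n * Ymon X X' Z Z' m' n' =
  iota (q ^ (2 * n * m')) * Ymon X X' Z Z' (m + m') (n + n').
Proof.
have q2U (k : int) : q ^ k \is a GRing.unit by exact: unitrXz.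
have ZXm (k : int) : Z * powz X X' k = iota (q ^ (2 * k)) * (powz X X' k * Z).
  by rewrite -exprz_exp; apply: powz_skew.
have XmZn : powz X X' m' * powz Z Z' n =
    iota (q ^ (- (2 * n * m'))) * (powz Z Z' n * powz X X' m').
  have -> : - (2 * n * m') = - (2 * m') * n :> int by ring.
  rewrite -exprz_exp; apply: powz_skew => //.
  by rewrite ZXm mulrA -rmorphM -exprzDr// addNr expr0z rmorph1 mul1r.
rewrite /Ymon !powzD// mulrA -(mulrA (powz X X' m)).
have -> : powz Z Z' n * powz X X' m' =
    iota (q ^ (2 * n * m')) * (powz X X' m' * powz Z Z' n).
  by rewrite XmZn mulrA -rmorphM -exprzDr// addrN expr0z rmorph1 mul1r.
by rewrite !mulrA -iotaC.
Qed.

(** This is T; the two signs exchange [a] and [b]. Both are written as integer powers of [q], as in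
    the seam and the gauge, so that entries compare by their exponents. *)
Definition seam_core (sigma : sign) : 'M[K]_4 :=
  2^-1 *: match sigma with
          | Plus => core (q ^ (-1)) (q ^ 1)
          | Minus => core (q ^ 1) (q ^ (-1))
          end.

(* The triple (k, m, n) stands for the diagonal entry k X^m Z^n. *)
Definition gauge (sigma : sign) (r : nat) : K * int * int :=
  nth (0, 0 : int, 0 : int)
    match sigma with
    | Plus => [:: (q ^ 0, 0, 0); (- q ^ 2, 1, 1);
                  (q ^ (-3), 1, 0); (- q ^ 0, 2, 1)]
    | Minus => [:: (q ^ 0, 0, 0); (q ^ (-2), 1, -1);
                   (- q ^ (-1), 1, 0); (- q ^ (-4), 2, -1)]
    end r.

Definition gauge_mx sigma : 'M[A]_4 :=
  diag_mx (\row_r (let: (k, m, n) := gauge sigma r in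
                   iota k * Ymon X X' Z Z' m n)).

(** Reduces one entry of S D = D T to addition of exponents and one identity of scalars in [K]. *)
Lemma gauge_entry (h k k' l t : K) m n m' n' m'' n'' :
  m + m' = m'' -> n + n' = n'' -> h * (k * k' * q ^ (2 * n * m')) = l * t ->
  iota h * (iota k * Ymon X X' Z Z' m n) * (iota k' * Ymon X X' Z Z' m' n') =
  iota l * Ymon X X' Z Z' m'' n'' * iota t.
Proof.
move=> <- <- E; have := Ymon_mul m n m' n'.
move: (Ymon X X' Z Z' m n) (Ymon X X' Z Z' m' n').
move: (Ymon _ _ _ _ (m + m') (n + n')) => y'' y y' yy'.
rewrite -!mulrA (mulrA y) -(iotaC k') -!mulrA yy' -[_ * iota t]iotaC !mulrA.
by rewrite -!rmorphM -!mulrA; congr (iota _ * _); rewrite mulrA -E !mulrA.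
Qed.

(** The gauge is forced: with first diagonal entry 1 and ones below the diagonal in column 0 of
    [core], the other diagonal entries must be those of column 0 of 2S. The remaining entries are
    then checked one by one. *)
Lemma seam_gauge sigma : seam q iota X X' Z Z' sigma *m gauge_mx sigma =
  gauge_mx sigma *m map_mx iota (seam_core sigma).
Proof.
have qz e : q * q ^ e = q ^ (1 + e) by rewrite exprzDr// expr1z.
apply/matrixP => r c; rewrite mul_mx_diag mul_diag_mx.
case: sigma; case: r => [[|[|[|[|//]]]] lr]; case: c => [[|[|[|[|//]]]] lc];
rewrite !mxE /= ?mulr0 ?mulr1 ?add0r ?addr0 ?mulr0 ?rmorph0 ?mulr0 ?mul0r //.
all: apply: gauge_entry; [reflexivity|reflexivity|].
(* The factor 1/2 cancels; what remains equates two signed powers of [q] whose exponents agree by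
   computation. *)
all: rewrite [RHS]mulrC -?[RHS]mulrA; congr (_ * _).
all: rewrite ?(mulN1r, mulrN1, mul1r, mulr1, mulNr, mulrN, opprK) ?qz
  -?exprzDr//.
all: reflexivity.
Qed.

(** Each diagonal entry is a unit times a monomial. The product of Y_{m,n} and Y_{-m,-n} is
    q^(-2nm), which the factor [q ^ (2 * n * m)] compensates. *)
Lemma gauge_mxV sigma : exists D', gauge_mx sigma *m D' = 1%:M.
Proof.
have entry k m n : k \is a GRing.unit ->
    (iota k * Ymon X X' Z Z' m n) *
    (iota (k^-1 * q ^ (2 * n * m)) * Ymon X X' Z Z' (- m) (- n)) = 1.
  move=> kU; have := Ymon_mul m n (- m) (- n);
    rewrite !addrN [Ymon _ _ _ _ 0 0]mulr1.
  move: (Ymon X X' Z Z' m n) (Ymon X X' Z Z' (- m) (- n)) => y y' yy'.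
  rewrite -mulrA (mulrA y) -iotaC -mulrA yy' !mulr1 -!rmorphM mulrA mulrA
    divrr//.
  by rewrite mul1r mulrN -exprzDr// addrN expr0z rmorph1.
exists (diag_mx (\row_r (let: (k, m, n) := gauge sigma r in
  iota (k^-1 * q ^ (2 * n * m)) * Ymon X X' Z Z' (- m) (- n)))).
rewrite mulmx_diag -diag_const_mx; congr diag_mx; apply/rowP => r; rewrite !mxE.
have qzU (k : int) : q ^ k \is a GRing.unit by exact: unitrXz.
by case: sigma; case: r => [[|[|[|[|//]]]] lr]; apply: entry; rewrite ?unitrN.
Qed.

Lemma seam_core_poly sigma : 2 \is a @GRing.unit K ->
  let T := seam_core sigma in
  T ^+ 4 - (3 / 2) *: T ^+ 2 + ((q + q^-1) / 2) *: T
     + (1 / 16 - 1 / 16 * (q + q^-1) ^+ 2)%:M = 0.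
Proof.
move=> U2; rewrite /seam_core; case: sigma; rewrite expr1z exprN1.
  by have := half_core_char U2 (mulVr qU); rewrite [q^-1 + q]addrC.
exact: half_core_char U2 (mulrV qU).
Qed.

(** For the quartic p, S D = D T gives p(S) D = D p(T) = 0, the coefficients being central; the
    right inverse of D then cancels it. *)
Lemma seam_poly sigma : 2 \is a @GRing.unit K ->
  let S := seam q iota X X' Z Z' sigma in
  S ^+ 4 - iota (3 / 2) *: S ^+ 2 + iota ((q + q^-1) / 2) *: S
     + (iota (1 / 16 - 1 / 16 * (q + q^-1) ^+ 2))%:M = 0.
Proof.
move=> U2 S; have [D' DD'] := gauge_mxV sigma.
have SD := seam_gauge sigma; rewrite -/S in SD.
move: (gauge_mx sigma) DD' SD => D DD' SD; set T := seam_core sigma in SD.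
clearbody S.
have map_iota k m n (M : 'M[K]_(m, n)) : 
    map_mx iota (k *: M) = iota k *: map_mx iota M.
  by apply/matrixP => i j; rewrite !mxE rmorphM.
have Dscale k (M : 'M[A]_4) : D *m (iota k *: M) = iota k *: (D *m M).
  apply/matrixP => i j; rewrite !mxE mulr_sumr; apply: eq_bigr => l _.
  by rewrite !mxE !mulrA iotaC.
have SnD n : S ^+ n *m D = D *m map_mx iota (T ^+ n).
  elim: n => [|n IH]; first by rewrite !expr0 map_mx1 mul1mx mulmx1.
  have -> : T ^+ n.+1 = T ^+ n *m T by rewrite exprSr.
  by rewrite exprSr -!mulmxE -mulmxA SD mulmxA IH -mulmxA -map_mxM.
have : (S ^+ 4 - iota (3 / 2) *: S ^+ 2 + iota ((q + q^-1) / 2) *: S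
     + (iota (1 / 16 - 1 / 16 * (q + q^-1) ^+ 2))%:M) *m D = 0.
  have scalarD k : (iota k)%:M *m D = iota k *: (D *m 1%:M).
    by rewrite -scalemx1 -scalemxAl mul1mx mulmx1.
  rewrite !mulmxDl mulNmx scalarD -!scalemxAl (SnD 4%N) (SnD 2%N) SD -!Dscale.
  rewrite -mulmxN -!mulmxDr -(map_mx1 iota) -!map_iota -map_mxN -!map_mxD
    scalemx1.
  by rewrite seam_core_poly// map_mx0 mulmx0.
by move/(congr1 (mulmx^~ D')); rewrite -mulmxA DD' mulmx1 mul0mx.
Qed.
End Conjugation.

(** * The quartic in the Laurent-Weyl algebra *)

Section WeylPart.
Variable F : fieldType.
Hypothesis F2 : (2 : F) != 0.

Lemma laurent2_unit : 2 \is a @GRing.unit (laurent F).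
Proof.
have twoP : tofrac (2%:P : {poly F}) = 2 by rewrite raddfMn /= rmorph_nat.
apply/unitrP; exists (Laurent (is_laurent_poly (2^-1)%:P)).
suff E : Laurent (is_laurent_poly (2^-1)%:P) * 2 = 1 :> laurent F by split;
  rewrite // mulrC.
apply: val_inj; rewrite rmorphM rmorph1 rmorph_nat /=.
by rewrite -(rmorph_nat (@tofrac {poly F})) -rmorphM -(rmorph_nat (@polyC F))
  -polyCM mulVf// rmorph1.
Qed.

Lemma weyl_seam_poly sigma : let q := laurent_q F in
   let S := weyl_seam F sigma in
   S ^+ 4 - (3 / 2)%:A *: S ^+ 2 + ((q + q^-1) / 2)%:A *: S
     + ((1 / 16 - 1 / 16 * (q + q^-1) ^+ 2)%:A)%:M = 0.
Proof.
move=> q S; apply: (seam_poly (iota := in_alg (laurent_weyl F))).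
- by move=> k x; rewrite /= mulr_algl mulr_algr.
- exact: laurent_q_unit.
- by apply/(etrans (lw_mulE _ _))/lw_piP; exact: lw_XXinv.
- by apply/(etrans (lw_mulE _ _))/lw_piP; exact: lw_XinvX.
- by apply/(etrans (lw_mulE _ _))/lw_piP; exact: lw_ZZinv.
- by apply/(etrans (lw_mulE _ _))/lw_piP; exact: lw_ZinvZ.
- rewrite /= mulr_algl; apply: etrans (lw_mulE _ _) _.
  apply: etrans; first by apply/lw_piP; exact: lw_ZX.
  by rewrite -!lw_mulE.
- exact: laurent2_unit.
Qed.
End WeylPart.

(** * Characteristic polynomial and eigenspaces of a diagonalizable matrix *)

Section Diag.
Variables (F : fieldType) (n : nat).

(** Over polynomials, U ('X - S) = ('X - diag d) U, and the nonzero determinant of U cancels. *)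
Lemma similar_diag_char_poly (U S : 'M[F]_n) d :
  U \in unitmx -> U *m S = diag_mx d *m U ->
  char_poly S = \prod_j ('X - (d 0 j)%:P).
Proof.
move=> Uu US; have detU : \det (map_mx polyC U) != 0.
  by rewrite det_map_mx polyC_eq0 -unitfE -unitmxE.
apply: (mulfI detU);
  rewrite /char_poly -det_mulmx /char_poly_mx mulmxBr -map_mxM US.
rewrite map_mxM scalar_mxC -mulmxBl det_mulmx mulrC; congr (_ * _).
by rewrite -/(char_poly_mx _) -/(char_poly _) char_poly_trig
  ?diag_mx_is_trig//; apply: eq_bigr => j _; rewrite mxE eqxx mulr1n.
Qed.

Lemma mxrank_diag (e : 'rV[F]_n) : \rank (diag_mx e) = #|[pred j | e 0 j != 0]|.
Proof.
(* [W] selects the coordinates with nonzero entry, so the matrix is W^T E W with E diagonal and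
   invertible of size [#|P|]. *)
set P := [pred j | _]; pose W : 'M[F]_(#|P|, n) := rowsub (@enum_val _ P) 1%:M.
have WWT : W *m W^T = 1%:M.
  by rewrite mul_rowsub_mx mul1mx; apply/matrixP => i j;
    rewrite !mxE (inj_eq enum_val_inj) eq_sym.
have freeW : row_free W by apply/row_freeP; exists W^T.
have -> : diag_mx e = W^T *m diag_mx (colsub (@enum_val _ P) e) *m W.
  apply/matrixP => i j; rewrite mul_mx_diag !mxE.
  have [Pi|nPi] := boolP (i \in P); last first.
    rewrite big1 => [|k _]; last first.
      rewrite !mxE; case: eqP => [ki|]; last by rewrite !mul0r.
      by case/negP: nPi; rewrite -ki enum_valP.
    by move: nPi; rewrite inE negbK => /eqP ->; rewrite mul0rn.
  rewrite (bigD1 (enum_rank_in Pi i))//= !mxE enum_rankK_in// eqxx mul1r big1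
    ?addr0 ?mulr_natr// => k kN.
  rewrite !mxE; case: eqP => [ki|]; last by rewrite !mul0r.
  by case/eqP: kN; apply: enum_val_inj; rewrite enum_rankK_in.
rewrite mxrankMfree// mxrankMfree ?mxrank_tr; first exact/eqP.
rewrite row_free_unit unitmxE det_diag unitfE; apply/prodf_neq0 => i _.
by rewrite mxE; have := enum_valP i; rewrite inE.
Qed.

(** U (S - z) = (diag d - z) U, so S - z has the rank of a diagonal matrix, and its kernel counts
    the zeros on that diagonal. *)
Lemma similar_diag_rank_eigenspace (U S : 'M[F]_n) d z :
  U \in unitmx -> U *m S = diag_mx d *m U ->
  \rank (eigenspace S z) = #|[pred j | d 0 j == z]|.
Proof.
move=> Uu US; rewrite mxrank_ker.
have UV : U *m (S - z%:M) = diag_mx (d - const_mx z) *m U.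
  by rewrite mulmxBr US raddfB /= diag_const_mx mulmxBl -scalar_mxC.
have -> : \rank (S - z%:M) = \rank (diag_mx (d - const_mx z)).
  by rewrite -(eqmxMfull (S - z%:M) (A := U)) ?row_full_unit// UV mxrankMfree//
    row_free_unit.
rewrite mxrank_diag -[X in (X - _)%N]card_ord -(cardC [pred j | d 0 j == z]).
rewrite (_ : #|[predC _]| = #|[pred j | (d - const_mx z) 0 j != 0]|) ?addnK//.
by apply: eq_card => j; rewrite !inE !mxE subr_eq0.
Qed.

Lemma mup_prod_XsubC (z : F) (I : finType) (d : I -> F) :
  mup z (\prod_j ('X - (d j)%:P)) = #|[pred j | d j == z]|.
Proof.
have -> : #|[pred j | d j == z]| = (\sum_j (d j == z))%N.
  by rewrite -sum1_card big_mkcond; apply: eq_bigr => j _; rewrite inE;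
    case: (d j == z).
have nz (r : seq I) : \prod_(j <- r) ('X - (d j)%:P) != 0.
  by rewrite prodf_seq_neq0; apply/allP => j _; rewrite polyXsubC_eq0.
elim: (index_enum I) => [|j r IH]; first by rewrite !big_nil mupNroot// root1.
by rewrite !big_cons mupM ?polyXsubC_eq0// IH -['X - _]expr1 mup_XsubCX eq_sym;
  case: eqP.
Qed.

End Diag.

(** Eigenspaces for distinct eigenvalues form a direct sum. A relation among the rows of [B]
    decomposes 0 along it, so by uniqueness each term is zero. *)
Lemma eigenrows_unit (F : fieldType) n (B T : 'M[F]_n) d :
  B *m T = diag_mx d *m B ->
  injective (d 0) -> (forall i, row i B != 0) -> B \in unitmx.
Proof.
move=> BT inj_d nzB; rewrite -row_free_unit -kermx_eq0;
  apply/rowV0P => u /sub_kermxP uB.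
have dir := mxdirect_sum_eigenspace T
  (in2W inj_d : {in xpredT &, injective (d 0)}).
case: (sub_dsumsmx dir (sub0mx 1 _)) => C _ _ uniqC.
have Crow i : u 0 i *: row i B = 0.
  transitivity (C i).
    apply: (uniqC (fun i => u 0 i *: row i B)) => //; last first.
      by rewrite -mulmx_sum_row uB.
    move=> j _; apply: scalemx_sub; apply/eigenspaceP.
    by rewrite -row_mul BT; apply/rowP => k; rewrite mul_diag_mx !mxE.
  apply/esym/(uniqC (fun=> 0)) => //; first by move=> j _; rewrite sub0mx.
  by rewrite big1.
by apply/rowP => i; move/eqP: (Crow i);
  rewrite scaler_eq0 (negbTE (nzB i)) orbF mxE => /eqP.
Qed.

(** * From matrices of blocks to operators on the tensor product *)

Section TensorOp.
Variables (R : realType) (N : nat).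
Local Notation C := R[i].

Lemma tensor_opE (S : 'M['M[C]_N]_4) r c i j :
  tensor_op S (mxtens_index (r, i)) (mxtens_index (c, j)) = S r c i j.
Proof.
rewrite /tensor_op summxE (bigD1 r)//= summxE (bigD1 c)//= tensmxE mxE !eqxx
  mul1r.
rewrite big1 ?addr0 => [|c' /negbTE c'c];
  last by rewrite tensmxE mxE eqxx eq_sym c'c mul0r.
rewrite big1 ?addr0// => r' /negbTE r'r; rewrite summxE big1// => c' _.
by rewrite tensmxE mxE eq_sym r'r mul0r.
Qed.

Lemma tensor_opM (S T : 'M['M[C]_N]_4) :
  tensor_op (S *m T) = tensor_op S *m tensor_op T.
Proof.
apply/matrixP => i j; case: (mxtens_indexP i) => r k;
  case: (mxtens_indexP j) => c l.
rewrite tensor_opE [RHS]mxE [in LHS]mxE summxE.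
rewrite (reindex (@mxtens_index (2 * 2) N)) /=; last first.
  by exists (@mxtens_unindex (2 * 2) N) => x _;
    [exact: mxtens_indexK | exact: mxtens_unindexK].
rewrite (eq_bigr (fun p : 'I_(2 * 2) * 'I_N => S r p.1 k p.2 * T p.1 c p.2 l));
  last first.
  by case=> a b _; rewrite !tensor_opE.
rewrite -(pair_bigA _ (fun (a : 'I_(2 * 2)) b => S r a k b * T a c b l)) /=.
by apply: eq_bigr => a _; rewrite mxE.
Qed.

(** The factor [1%:M] of size N produced here is the source of the multiplicity N. *)
Lemma tensor_op_scalar (T : 'M[C]_4) :
  tensor_op (map_mx (@scalar_mx C N) T) = (T : 'M_(2 * 2)) *t 1%:M.
Proof.
apply/matrixP => i j; case: (mxtens_indexP i) => r k;
  case: (mxtens_indexP j) => c l.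
by rewrite tensor_opE tensmxE !mxE mulr_natr.
Qed.

End TensorOp.

(** * Explicit eigenvectors of the scalar matrix *)

Section CoreEigen.
Variables (F : fieldType) (a b : F).

(** For v core = x v, column 0 reads v1 + v2 + v3 = x v0. Substituted in columns 1 and 2 it gives (1
    - bx) v0 = (x - b) v1 and (1 - ax) v0 = (x - a) v2. The choice v0 = (x - a)(x - b) clears
    denominators, and column 0 yields v3. *)
Definition core_eigenrow (x : F) : 'rV[F]_4 :=
  \row_j nth 0 [::
    (x - a) * (x - b); (1 - b * x) * (x - a); (1 - a * x) * (x - b);
    x ^+ 3 - (2 + a * b) * x + (a + b)] j.

(* The first three columns are identities in x, a and b; in the last one the two
   sides differ by the characteristic polynomial of core a b at x. *)
Lemma core_eigenrowP (x : F) :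
  x ^+ 4 - (3 + 3 * (a * b)) * x ^+ 2 + (3 + a * b) * (a + b) * x
    = a * b + a ^+ 2 + b ^+ 2 ->
  core_eigenrow x *m core a b = x *: core_eigenrow x.
Proof.
move=> Px; apply/rowP => c; rewrite !mxE !big_ord_recl big_ord0.
case: c => [[|[|[|[|//]]]] lc]; rewrite !mxE /=; [ring|ring|ring|].
apply/subr0_eq;
  rewrite -[RHS](subrr (a * b + a ^+ 2 + b ^+ 2)) -[X in _ = _ - X]Px; ring.
Qed.

Lemma core_eigenrow_neq0 (x : F) : x != a -> x != b -> core_eigenrow x != 0.
Proof.
move=> xa xb; apply/eqP => /rowP/(_ 0)/eqP; rewrite !mxE /= mulf_eq0 !subr_eq0.
by rewrite (negbTE xa) (negbTE xb).
Qed.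

End CoreEigen.

(** * The Weyl relation for clock and shift *)

Section ClockShiftRelations.
Variables (R : realType) (N : nat).
Local Notation C := R[i].

Lemma shift_unit : shift R N \in unitmx.
Proof.
suff : shift R N *m (shift R N)^T = 1%:M by case/mulmx1_unit.
apply/matrixP => r s; rewrite !mxE.
under eq_bigr do rewrite !mxE.
rewrite -(reindex_inj (@ordS_inj N) (P := predT)
  (F := fun c => (r == c)%:R * (s == c)%:R)) /=.
rewrite (bigD1 r)//= eqxx mul1r big1 ?addr0 1?eq_sym// => c /negbTE cr.
by rewrite eq_sym cr mul0r.
Qed.

Lemma clock_unit (w : C) : w != 0 -> clock N w \in unitmx.
Proof.
move=> w0; rewrite unitmxE det_diag unitfE; apply/prodf_neq0 => i _.
by rewrite mxE expf_neq0.
Qed.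

Lemma clock_shift (w : C) : w ^+ N = 1 ->
  clock N w *m shift R N = w *: (shift R N *m clock N w).
Proof.
move=> wN; apply/matrixP => r c; rewrite mul_diag_mx mul_mx_diag !mxE.
case: eqP => [->|_]; last by rewrite mul0r !mulr0.
rewrite mulr1 mul1r /= -exprS exprS.
(* The cyclic successor is a remainder modulo N; [w ^+ N = 1] absorbs the wrap-around. *)
by case: N c wN => [|n] // c wN; rewrite expr_mod// -exprS.
Qed.

End ClockShiftRelations.

(** * Complex exponentials of real angles *)

Section Expi.
Variable (R : realType).

Lemma expiD (x y : R) : expi (x + y) = expi x * expi y.
Proof. by rewrite /expi cosD sinD; simpc; congr (_ +i* _); rewrite addrC. Qed.

Lemma expi0 : expi (0 : R) = 1.
Proof. by rewrite /expi cos0 sin0. Qed.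

Lemma expiX (x : R) n : expi x ^+ n = expi (x *+ n).
Proof.
elim: n => [|n IH]; first by rewrite expr0 mulr0n expi0.
by rewrite exprS mulrS expiD IH.
Qed.

Lemma expiN (x : R) : expi x * expi (- x) = 1.
Proof. by rewrite -expiD subrr expi0. Qed.

Lemma expi_neq0 (x : R) : expi x != 0.
Proof.
by apply: contra_eq_neq (expiN x) => ->; rewrite mul0r eq_sym oner_eq0.
Qed.

Lemma expiV (x : R) : (expi x)^-1 = expi (- x).
Proof. by apply: (mulfI (expi_neq0 x)); rewrite expiN mulfV ?expi_neq0. Qed.

Lemma conj_expi (x : R) : Num.conj (expi x) = expi (- x).
Proof. by rewrite /expi cosN sinN. Qed.

Lemma expi_mulr_conj (x : R) : expi x * Num.conj (expi x) = 1.
Proof. by rewrite conj_expi expiN. Qed.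

End Expi.

(** * Unitarity of the output normalization *)

Section OutputUnitary.
Local Open Scope sesquilinear_scope.
Variables (R : realType) (N : nat).
Local Notation C := R[i].

Lemma tensmx_unitary m n (A : 'M[C]_m) (B : 'M[C]_n) :
  A \is unitarymx -> B \is unitarymx -> A *t B \is unitarymx.
Proof.
move=> /unitarymxP AA /unitarymxP BB; apply/unitarymxP.
rewrite trmx_tens map_mxT tensmx_mul AA BB.
apply/matrixP => i j; case: (mxtens_indexP i) => r k;
  case: (mxtens_indexP j) => c l.
rewrite tensmxE !mxE -natrM mulnb; congr (_ _ _).
by rewrite (inj_eq (can_inj (@mxtens_indexK m n))).
Qed.

Lemma output_op_unitary sigma (eta : 'Z_(2 * N)) :
  output_op R sigma eta \is unitarymx.
Proof.
have U1 n : (1%:M : 'M[C]_n) \is unitarymx.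
  by apply/unitarymxP; rewrite trmx1 map_mx1 mulmx1.
apply: tensmx_unitary; last exact: U1.
apply: tensmx_unitary; first exact: U1.
apply/unitarymxP; rewrite tr_diag_mx map_diag_mx mulmx_diag -diag_const_mx.
congr diag_mx; apply/rowP => j; rewrite !mxE /output_phase expiX.
by case: sigma; case: (j == 0); rewrite ?rmorph1 ?mulr1// expi_mulr_conj.
Qed.
End OutputUnitary.

(** * The four eigenvalues and diagonalization of the normalized seam *)

Section Spectrum.
Variable R : realType.
Local Notation C := R[i].

Definition seam_eigs (theta : R) : seq R :=
  [:: - (1 / 2) + cos (theta / 2); - (1 / 2) - cos (theta / 2);
      1 / 2 + sin (theta / 2); 1 / 2 - sin (theta / 2)].

(** For the half angle, c = cos and s = sin are positive with c^2 + s^2 = 1. Any coincidence would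
    force c = 0, s = 0, c + s = 1 or -1, or c - s = 1 or -1. *)
Lemma seam_eigs_uniq theta : 0 < theta < pi -> uniq (seam_eigs theta).
Proof.
move=> /andP[t0 tpi].
have c0 : 0 < cos (theta / 2) by apply: cos_gt0_pihalf; apply/andP; split; lra.
have s0 : 0 < sin (theta / 2) by apply: sin_gt0_pihalf; apply/andP; split; lra.
have cs := cos2Dsin2 (theta / 2).
rewrite /seam_eigs; move: (cos _) (sin _) c0 s0 cs => c s c0 s0 cs.
rewrite /= !inE !negb_or andbT -!andbA; apply/and5P; split;
  last (apply/andP; split);
  apply/eqP => E; try (by lra); nra.
Qed.

(** The equation is (m^2 - 1)^2 = (2m - d)^2. It splits into (m - 1)^2 = 2 - d = 4 sin^2(theta/2)
    and (m + 1)^2 = 2 + d = 4 cos^2(theta/2). *)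
Lemma seam_eigs_root theta x : x \in seam_eigs theta ->
  let m := 2 * x in let d := 2 * cos theta in
  m ^+ 4 - 6 * m ^+ 2 + 4 * d * m = d ^+ 2 - 1.
Proof.
have thetaE : theta = (theta / 2) *+ 2 by rewrite mulr2n; lra.
have cosE : cos theta = 2 * cos (theta / 2) ^+ 2 - 1.
  by rewrite [in LHS]thetaE cos_mulr2n mulr_natl.
have sinE : cos theta = 1 - 2 * sin (theta / 2) ^+ 2.
  by rewrite cosE cos2sin2; ring.
rewrite !inE => /or4P[] /eqP -> /=.
- by rewrite cosE; field.
- by rewrite cosE; field.
- by rewrite sinE; field.
- by rewrite sinE; field.
Qed.

(** Keeps the real eigenvalues away from [a] and [b], where the first entry of [core_eigenrow]
    vanishes. *)
Lemma real_neq_expi (x t : R) : sin t != 0 -> x%:C != expi t.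
Proof. by move=> st; apply: contra_neq st => -[_ <-]. Qed.

Lemma expiD_expiN (t : R) : expi t + expi (- t) = (2 * cos t)%:C.
Proof.
rewrite /expi cosN sinN; apply/eqP.
by rewrite eq_complex /= subrr eqxx andbT mulr_natl mulr2n.
Qed.

Lemma core_diag (a b : C) theta :
  0 < theta < pi -> a * b = 1 -> a + b = (2 * cos theta)%:C ->
  (forall x : R, x%:C != a) -> (forall x : R, x%:C != b) ->
  exists2 B : 'M[C]_4, B \in unitmx &
    B *m (2^-1 *: core a b) =
    diag_mx (\row_r (nth 0 (seam_eigs theta) r)%:C) *m B.
Proof.
move=> th ab1 abd na nb.
pose t r := nth 0 (seam_eigs theta) r.
have teig (r : 'I_4) : t r \in seam_eigs theta by apply: mem_nth.
pose B : 'M[C]_4 := \matrix_r core_eigenrow a b (2 * t r)%:C.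
have BT : B *m (2^-1 *: core a b) = diag_mx (\row_r (t r)%:C) *m B.
  apply/row_matrixP => r; rewrite row_mul rowK -scalemxAr core_eigenrowP.
    apply/rowP => j; rewrite mul_diag_mx !mxE mulrA; congr (_ * _).
    by rewrite rmorphM rmorph_nat mulKf// pnatr_eq0.
  (* Carried over to the complex numbers, with [a + b] for 2 cos theta and [a * b = 1], this is the
     characteristic equation of [core a b] at [2 * t r]. *)
  have /(congr1 (real_complex R)) := seam_eigs_root (teig r).
  rewrite /=; move: (2 * t r) (2 * cos theta) abd => m d abd.
  rewrite !(rmorphD, rmorphN, rmorphXn, rmorphM, rmorph_nat, rmorph1) /= -abd
    => E.
  transitivity (m%:C ^+ 4 - 6 * m%:C ^+ 2 + 4 * (a + b) * m%:C).
    by rewrite ab1; ring.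
  rewrite E (_ : (a + b) ^+ 2 = 2 * (a * b) + a ^+ 2 + b ^+ 2); last ring.
  by rewrite ab1; ring.
exists B => //; apply: (eigenrows_unit BT).
  move=> r s; rewrite !mxE => /complexI trs; apply/val_inj/eqP.
  by rewrite -(nth_uniq 0 _ _ (seam_eigs_uniq th));
    [apply/eqP | exact: ltn_ord | exact: ltn_ord].
by move=> r; rewrite rowK; exact: core_eigenrow_neq0.
Qed.

Lemma seam_core_diag sigma theta : 0 < theta < pi ->
  exists2 B : 'M[C]_4, B \in unitmx &
    B *m seam_core (expi theta) sigma =
    diag_mx (\row_r (nth 0 (seam_eigs theta) r)%:C) *m B.
Proof.
move=> th; have s0 : sin theta != 0 by rewrite gt_eqF// sin_gt0_pi.
have sN0 : sin (- theta) != 0 by rewrite sinN oppr_eq0.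
have eM := expiN theta; have eD := expiD_expiN theta.
rewrite /seam_core exprN1 expr1z expiV.
case: sigma; first rewrite mulrC in eM; first rewrite addrC in eD.
all: by apply: core_diag => // x; apply: real_neq_expi.
Qed.

Lemma tensor_diag N (d : 'rV[C]_4) :
  (diag_mx d : 'M_(2 * 2)) *t (1%:M : 'M[C]_N) =
  diag_mx (\row_j d 0 (@mxtens_unindex (2 * 2) N j).1).
Proof.
apply/matrixP => i j; case: (mxtens_indexP i) => r k;
  case: (mxtens_indexP j) => c l.
rewrite tensmxE !mxE mxtens_indexK /= (inj_eq (can_inj (@mxtens_indexK (2 * 2)
  N))).
by rewrite xpair_eqE -mulr_natr -[RHS]mulr_natr -mulrA -natrM mulnb.
Qed.

(** Composes three changes of basis: O' undoes the output normalization, D' the gauge, and B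
    diagonalizes T. *)
Lemma conj_diag n (O O' D D' S T B E : 'M[C]_n) :
  O' *m O = 1%:M -> D' *m D = 1%:M -> S *m D = D *m T -> B *m T = E *m B ->
  (B *m (D' *m O')) *m (O *m S *m O') = E *m (B *m (D' *m O')).
Proof.
move=> O'O D'D SD BT; have SE : S = D *m T *m D'.
  by rewrite -SD -mulmxA (mulmx1C D'D) mulmx1.
rewrite SE -!mulmxA (mulmxA O') O'O mul1mx (mulmxA D') D'D mul1mx.
by rewrite (mulmxA B) BT !mulmxA.
Qed.

Lemma normalized_seam_diag N sigma (eta : 'Z_(2 * N)) theta :
  0 < theta < pi -> (0 < N)%N -> expi theta ^+ 2 ^+ N = 1 ->
  exists2 U : 'M[C]_(2 * 2 * N), U \in unitmx &
    U *m normalized_seam (expi theta) sigma eta =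
    diag_mx (\row_j
      (nth 0 (seam_eigs theta) (@mxtens_unindex (2 * 2) N j).1)%:C) *m U.
Proof.
move=> th N0 qN; set q := expi theta; have q0 : q != 0 := expi_neq0 theta.
have qU : q \is a GRing.unit by rewrite unitfE.
pose X := shift R N; pose Z := clock N (q ^+ 2).
have Xu : X \in unitmx := shift_unit R N.
have Zu : Z \in unitmx by apply: clock_unit; rewrite expf_neq0.
have iotaC (k : C) (x : 'M[C]_N) : @scalar_mx C N k * x = x * @scalar_mx C N k.
  by rewrite -!mulmxE scalar_mxC.
have ZX : Z * X = @scalar_mx C N (q ^+ 2) * (X * Z).
  by rewrite -!mulmxE mul_scalar_mx; exact: clock_shift.
have SD := seam_gauge iotaC qU
  (mulmxV Xu) (mulVmx Xu) (mulmxV Zu) (mulVmx Zu) ZX sigma.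
have [D' DD'] := gauge_mxV iotaC qU
  (mulmxV Xu) (mulVmx Xu) (mulmxV Zu) (mulVmx Zu) ZX sigma.
rewrite /normalized_seam /clock_seam.
have /unitarymxP := output_op_unitary R sigma eta.
set O := output_op _ _ _; set O' := map_mx _ _ => OO'.
set D := gauge_mx _ _ _ _ _ _ _ in SD DD'; set S := seam _ _ _ _ _ _ _ in SD *.
have O'O : O' *m O = 1%:M by exact: mulmx1C.
(* After [tensor_op] the entries lie in a field, so the right inverse of the gauge is also a left
   inverse. *)
have D'D : tensor_op D' *m tensor_op D = 1%:M.
  apply: mulmx1C;
    rewrite -tensor_opM DD' -(map_mx1 (@scalar_mx C N)) tensor_op_scalar.
  by rewrite -diag_const_mx tensor_diag -diag_const_mx; congr diag_mx;
    apply/rowP => j; rewrite !mxE.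
have [B Bu BT] := seam_core_diag sigma th.
exists ((B : 'M_(2 * 2)) *t (1%:M : 'M[C]_N) *m (tensor_op D' *m O')).
  rewrite unitmx_mul tensmx_unit ?unitmx1 -?lt0n// unitmx_mul /=.
  by case/mulmx1_unit: D'D => -> _; case/mulmx1_unit: O'O => ->.
apply: (conj_diag O'O D'D (T := (seam_core q sigma : 'M_(2 * 2)) *t 1%:M)).
  by rewrite -tensor_opM SD tensor_opM tensor_op_scalar.
rewrite tensmx_mul mulmx1 BT -[X in _ *t X]mulmx1 -tensmx_mul tensor_diag;
  congr (diag_mx _ *m _).
by apply/rowP => j; rewrite !mxE.
Qed.

Lemma card_mxtens_row m n (r : 'I_m) :
  #|[pred j : 'I_(m * n) | (mxtens_unindex j).1 == r]| = n.
Proof.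
have E : [pred j : 'I_(m * n) | (mxtens_unindex j).1 == r] =i
    image (@mxtens_index m n) [predX pred1 r & predT].
  move=> j; case: (mxtens_indexP j) => a b.
  rewrite mem_image; last exact: can_inj (@mxtens_indexK m n).
  by rewrite inE mxtens_indexK [RHS]andbT.
rewrite (eq_card E) card_image; last exact: can_inj (@mxtens_indexK m n).
by rewrite cardX card1 mul1n card_ord.
Qed.

Lemma seam_angle (N M : nat) : (1 <= M < N)%N ->
  let theta : R := pi * M%:R / N%:R in
  0 < theta < pi /\ expi theta ^+ 2 ^+ N = 1.
Proof.
move=> /andP[M0 MN] theta;
  have N0 : 0 < N%:R :> R by rewrite ltr0n (leq_trans _ MN).
have p0 := pi_gt0 R; split.
  rewrite /theta; apply/andP; split; first by apply: divr_gt0 => //;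
    apply: mulr_gt0; rewrite ?ltr0n.
  by rewrite ltr_pdivrMr// ltr_pM2l// ltr_nat.
rewrite -exprM mulnC exprM expiX.
have -> : theta *+ N = pi *+ M.
  by rewrite -mulr_natr divfK ?gt_eqF// mulr_natr.
have epi : expi pi ^+ 2 = 1 :> C.
  by rewrite expiX /expi cos2pi sin2pi.
by rewrite -expiX -exprM mulnC exprM epi expr1n.
Qed.

End Spectrum.

Theorem theorem3p4 (R : realType) (sigma : sign) :
  (let q := laurent_q R[i] in
   let S := weyl_seam R[i] sigma in
   S ^+ 4 - (3 / 2)%:A *: S ^+ 2 + ((q + q^-1) / 2)%:A *: S
     + ((1 / 16 - 1 / 16 * (q + q^-1) ^+ 2)%:A)%:M = 0)
  /\
  (forall N M : nat, (2 <= N)%N -> (1 <= M < N)%N -> coprime M N ->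
   forall eta : 'Z_(2 * N),
   let theta : R := pi * M%:R / N%:R in
   let S := normalized_seam (expi theta) sigma eta in
   let eigs : seq R :=
     [:: - (1 / 2) + cos (theta / 2); - (1 / 2) - cos (theta / 2);
         1 / 2 + sin (theta / 2); 1 / 2 - sin (theta / 2)] in
   [/\ forall z : R[i], eigenvalue S z = (z \in [seq x%:C | x <- eigs]),
       uniq eigs
     & forall x, x \in eigs ->
         mup x%:C (char_poly S) = N /\ \rank (eigenspace S x%:C) = N]).
Proof.

split; first by apply: weyl_seam_poly; rewrite pnatr_eq0.
move=> N M N2 MN _ eta theta S eigs.
have [th qN] := seam_angle R MN.
have N0 : (0 < N)%N by case/andP: MN => _; exact: leq_trans.
have [U Uu US] := normalized_seam_diag sigma eta th N0 qN.
rewrite -/S in US; have eigs_uniq : uniq eigs := seam_eigs_uniq th.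
(* As the four values are distinct, equal diagonal entries have the same index in the factor of size
   4, and each such index occurs N times. *)
have count_eig (r : 'I_4) :
    #|[pred j | (\row_j (nth 0 eigs (@mxtens_unindex (2 * 2) N j).1)%:C) 0 j
                == (nth 0 eigs r)%:C]| = N.
  rewrite -[RHS](card_mxtens_row N (r : 'I_(2 * 2))); apply: eq_card => j.
  rewrite !inE mxE (inj_eq (@complexI _)) nth_uniq //; exact: ltn_ord.
split=> //.
- move=> z;
  rewrite /eigenvalue -mxrank_eq0 (similar_diag_rank_eigenspace _ Uu US) -lt0n.
  apply/card_gt0P/mapP => [[j]|[x /(nthP 0)[r r4 <-] ->]].
    rewrite inE mxE => /eqP <-;
      exists (nth 0 eigs (@mxtens_unindex (2 * 2) N j).1) => //.
    by apply: mem_nth; exact: ltn_ord.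
  by apply/card_gt0P; rewrite (count_eig (Ordinal r4)).
- move=> x /(nthP 0)[r r4 <-].
  rewrite (similar_diag_rank_eigenspace _ Uu US) (similar_diag_char_poly Uu US)
    mup_prod_XsubC.
  by rewrite (count_eig (Ordinal r4)).
Qed.
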